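(* Let $R$ be a semidistributive (left) nearring with an identity. If the additive group $R^+=(R,+)$ has no elements of order $2$, then $R$ is an associative ring; that is, $(R,+)$ is abelian and, in addition to the left distributive law, the right distributive law $(r+s)t=rt+st$ holds for all $r,s,t\in R$.
   Context: A (left) nearring is a set $R$ with two binary operations $+$ and $\cdot$ such that (1) $(R,+)$ is a (not necessarily abelian) group with neutral element $0$; (2) $(R,\cdot)$ is a semigroup; (3) $x\cdot(y+z)=x\cdot y+x\cdot z$ for all $x,y,z\in R$. It is not assumed that $0\cdot x=0$. The group $R^+=(R,+)$ is called the additive group of $R$. The nearring $R$ is a nearring with identity if the semigroup $(R,\cdot)$ is a monoid, i.e. it has a two-sided identity element $i$. A nearring $R$ is called semidistributive if $(r+s+r)t=rt+st+rt$ for all $r,s,t\in R$. *)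

(* Defs.v *)
From HB Require Import structures.
From mathcomp Require Import all_boot.

Set Implicit Arguments.
Unset Strict Implicit.
Unset Printing Implicit Defensive.

Declare Scope nearring_scope.
Delimit Scope nearring_scope with NR.
Local Open Scope nearring_scope.

(* These notations use only the operations of [baseZmodType] and [magmaType],  *)
(* which come without axioms: the [+] of ssralg would be commutative.          *)
Notation "0" := (@Algebra.zero _) : nearring_scope.
Notation "x + y" := (Algebra.add x y) : nearring_scope.
Notation "- x" := (Algebra.opp x) : nearring_scope.
Notation "x *+ n" := (Algebra.natmul x n) : nearring_scope.
Notation "x * y" := (mul x y) : nearring_scope.

(* Left nearrings: [+] is an arbitrary group law and [0 * x = 0] is not        *)
(* assumed. The carrier is any type (no choiceType), which is why the group    *)
(* and semigroup axioms are listed here instead of inherited from [groupType]  *)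
(* and [semigroupType].                                                        *)
HB.mixin Record isNearRing R of Algebra.BaseZmodule R & Magma R := {
  nr_addA : forall x y z : R, x + (y + z) = (x + y) + z;
  nr_add0 : forall x : R, 0 + x = x;
  nr_addx0 : forall x : R, x + 0 = x;
  nr_addN : forall x : R, - x + x = 0;
  nr_addxN : forall x : R, x + - x = 0;
  nr_mulA : forall x y z : R, x * (y * z) = (x * y) * z;
  nr_mulDr : forall x y z : R, x * (y + z) = x * y + x * z
}.

#[short(type="nearRingType")]
HB.structure Definition NearRing :=
  { R of isNearRing R & Algebra.BaseZmodule R & Magma R }.

Definition with_identity (R : nearRingType) : Prop :=
  exists i : R, forall x : R, i * x = x /\ x * i = x.

Definition semidistributive (R : nearRingType) : Prop :=
  forall r s t : R, (r + s + r) * t = r * t + s * t + r * t.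

(* Additive order exactly [n], for an element of a possibly infinite group.    *)
Definition has_add_order (R : nearRingType) (x : R) (n : nat) : Prop :=
  [/\ (0 < n)%N, x *+ n = 0 & forall m : nat, (0 < m < n)%N -> x *+ m <> 0].

(* Main.v *)
Require Import Defs.
From mathcomp Require Import all_boot.
From Stdlib Require Import Classical.

Local Open Scope nearring_scope.

(** Semidistributivity applied to [r + - r + r = r] gives
    [(- r) * t = - (r * t)], hence [(- i) * t = - t] for the identity [i].
    Negation is therefore left multiplication by [- i], which is additive by
    the left distributive law; a group in which negation is additive is abelian
    ([nr_addC]). In the abelian group [R], expanding [((r + s) + (r + s)) * t]
    both as twice [(r + s) * t] and as [(r + (s + s) + r) * t] shows that twice
    the defect [(r + s) * t - (r * t + s * t)] vanishes. The absence of elements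
    of order two cancels this last factor two; it also gives [0 * t = 0], which
    is needed to expand [(s + s) * t] as [(s + 0 + s) * t]. *)

Section AdditiveGroup.
Context {R : nearRingType}.
Implicit Types x y z : R.

Lemma nr_addIl x y z : x + y = x + z -> y = z.
Proof.
by move/(congr1 (Algebra.add (- x))); rewrite !nr_addA !nr_addN !nr_add0.
Qed.

Lemma nr_addIr x y z : y + x = z + x -> y = z.
Proof.
by move/(congr1 (Algebra.add^~ (- x))); rewrite -!nr_addA !nr_addxN !nr_addx0.
Qed.

Lemma nr_oppK x : - - x = x.
Proof. by apply: (@nr_addIl (- x)); rewrite nr_addxN nr_addN. Qed.

Lemma nr_oppD x y : - (x + y) = - y + - x.
Proof.
apply: (@nr_addIl (x + y)).
by rewrite nr_addxN nr_addA -(nr_addA x) nr_addxN nr_addx0 nr_addxN.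
Qed.

Lemma nr_mulx0 x : x * 0 = 0.
Proof. by apply: (@nr_addIl (x * 0)); rewrite -nr_mulDr !nr_addx0. Qed.

(** [hord] only refutes [x <> 0], so the conclusion [x = 0] needs excluded
    middle: equality on [R] need not be decidable. *)
Lemma double_eq0 (hord : forall x, ~ has_add_order x 2) x : x + x = 0 -> x = 0.
Proof.
move=> xx0; apply: NNPP => x_neq0; apply: (hord x).
by split=> // -[|[|m]].
Qed.

End AdditiveGroup.

Section Semidistributive.
Context {R : nearRingType}.
Hypothesis hsd : semidistributive R.
Hypothesis hord : forall x : R, ~ has_add_order x 2.
Implicit Types r s t x y : R.

(** At [r = s = 0], semidistributivity says that adding [0 * t] twice changes
    nothing. *)
Lemma nr_mul0x t : 0 * t = 0.
Proof.
apply: (double_eq0 hord); apply: (@nr_addIl _ (0 * t)).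
by rewrite nr_addA -hsd !nr_addx0.
Qed.

Lemma nr_mulNx r t : (- r) * t = - (r * t).
Proof.
have := hsd r (- r) t; rewrite nr_addxN nr_add0 => eq_rt.
apply: (@nr_addIl _ (r * t)); apply: (@nr_addIr _ (r * t)).
by rewrite -eq_rt nr_addxN nr_add0.
Qed.

Lemma nr_mul_double r t : (r + r) * t = r * t + r * t.
Proof. by have := hsd r 0 t; rewrite nr_mul0x !nr_addx0. Qed.

(** Negation is left multiplication by [- i], hence additive as well as
    order-reversing. *)
Lemma nr_addC (hid : with_identity R) x y : x + y = y + x.
Proof.
have [i i_id] := hid.
have mulNi z : (- i) * z = - z by rewrite nr_mulNx (i_id z).1.
have := nr_mulDr (- i) (- x) (- y).
by rewrite !mulNi nr_oppD !nr_oppK.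
Qed.

Lemma nr_mulDl (addC : forall x y, x + y = y + x) r s t :
  (r + s) * t = r * t + s * t.
Proof.
have addDD x y : (x + y) + (x + y) = x + (y + y) + x.
  by rewrite {2}(addC x y) !nr_addA.
have eq2 : (r + s) * t + (r + s) * t
         = (r * t + s * t) + (r * t + s * t).
  by rewrite -nr_mul_double !addDD hsd nr_mul_double.
set a := (r + s) * t in eq2 *; set b := r * t + s * t in eq2 *.
apply: (@nr_addIr _ (- b)); rewrite nr_addxN.
apply: (double_eq0 hord).
by rewrite addDD addC nr_addA eq2 -nr_addA (nr_addA b (- b)) nr_addxN nr_add0 nr_addxN.
Qed.

End Semidistributive.

Theorem mainTheorem2 (R : nearRingType)
    (hid : with_identity R)
    (hsd : semidistributive R)
    (hord : forall x : R, ~ has_add_order x 2) :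
  (forall x y : R, x + y = y + x) /\
  (forall r s t : R, (r + s) * t = r * t + s * t).
Proof.
have addC := nr_addC hsd hid.
by split=> // r s t; apply: nr_mulDl.
Qed.
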